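(* Let $n\ge1$, $m\ge1$ and let $\mathcal{B}$ be a Boolean algebra with $2^m$ elements. Then $D^{\mathcal{B}}_n$ has exactly $(n+1)^m$ elements and $Boo^{\mathcal{B}}_n$ has exactly $2^m$ elements.
   Context: For a Boolean algebra $\mathcal{B}$ and $n\ge1$, $B^{\mathcal{B}}_n=\{z\in|\mathcal{B}|^{n+1}: (\bigwedge_{i=1}^k z_{[i]})\vee z_{[k+1]}=1 \text{ for all } 1\le k\le n\}$, where $z_{[i]}$ is the $i$-th coordinate of $z$; $D^{\mathcal{B}}_n=\{z\in B^{\mathcal{B}}_n: z_{[1]}=1\}$; $Boo^{\mathcal{B}}_n=\{z\in B^{\mathcal{B}}_n: z_{[1]}\wedge z_{[2]}=0\}$. *)

(* Defs.v *)
From HB Require Import structures.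
From mathcomp Require Import all_boot all_order.

Set Implicit Arguments.
Unset Strict Implicit.
Unset Printing Implicit Defensive.

Local Open Scope order_scope.

(* z_[i]: coordinates are numbered from 1, for 1 <= i <= n + 1. *)
Definition coord (T : Type) (n : nat) (z : n.+1.-tuple T) (i : nat) : T :=
  tnth z (inord i.-1).

Section BooleanTuples.
Variables (d : Order.disp_t) (B : finCTBDistrLatticeType d) (n : nat).

Definition Bset : {set n.+1.-tuple B} :=
  [set z : n.+1.-tuple B | [forall k : 'I_n.+1, (1 <= k)%N ==>
    ((\meet_(1 <= i < k.+1) coord z i) `|` coord z k.+1 == \top)]].

Definition Dset : {set n.+1.-tuple B} :=
  [set z in Bset | coord z 1 == \top].

Definition Booset : {set n.+1.-tuple B} :=
  [set z in Bset | coord z 1 `&` coord z 2 == \bot].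

End BooleanTuples.

Arguments Bset {d} B n.
Arguments Dset {d} B n.
Arguments Booset {d} B n.

(* Main.v *)
Require Import Defs.
From HB Require Import structures.
From mathcomp Require Import all_boot all_order.

(** Since [(z_1 /\ ... /\ z_k) \/ y] is the meet of the [z_i \/ y], a tuple lies
    in [B_n] exactly when any two of its coordinates at distinct places join to
    the top; equivalently, every atom lies below all coordinates but at most one.
    A tuple of [D_n] thus amounts to choosing, for each of the [m] atoms, the
    coordinate among the last [n] that misses it, or none, hence [(n+1)^m]
    tuples. In [Boo_n] the second coordinate is the complement of the first, so
    their meet is bottom and all the later coordinates are top. *)

Section FiniteBooleanAlgebra.
Set Implicit Arguments.
Unset Strict Implicit.
Import Order.Theory.
Local Open Scope order_scope.
Variables (d : Order.disp_t) (B : finCTBDistrLatticeType d).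
Implicit Types (x y a b : B).

Definition atom a :=
  (a != \bot) && [forall y, (y <= a) ==> (y == \bot) || (y == a)].

Lemma atomP a :
  reflect (a != \bot /\ forall y, y <= a -> y = \bot \/ y = a) (atom a).
Proof.
apply: (iffP andP) => -[a0 Ha]; split=> //.
  by move=> y /(implyP (forallP Ha y))/orP[]/eqP; [left | right].
by apply/forallP=> y; apply/implyP=> /Ha[]->; rewrite eqxx ?orbT.
Qed.

Lemma atom_exists x : x != \bot -> exists2 a, atom a & a <= x.
Proof.
move=> x0.
have Px : (x != \bot) && (x <= x) by rewrite x0 lexx.
(* Among the nonzero elements below [x], take one with the fewest elements below it; a nonzero
   element strictly under it would have a strictly smaller down-set. *)
case: (@arg_minnP _ x (fun y => (y != \bot) && (y <= x))
         (fun y => #|[pred t | t <= y]|) Px).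
move=> a /andP[a0 ax] amin; exists a => //; apply/atomP; split=> // y ya.
have [->|y0] := eqVneq y \bot; [by left | right].
have := amin y; rewrite y0 (le_trans ya ax) => /(_ isT) le_card.
apply/eqP; apply: contraLR le_card => y_neq_a; rewrite -ltnNge.
apply: proper_card; apply/properP; split.
  by apply/subsetP=> t; rewrite !inE => /le_trans; apply.
exists a; rewrite !inE //.
by apply: contra y_neq_a => ay; rewrite eq_le ya ay.
Qed.

(** Atoms are join-prime: by distributivity [a] is the join of its meets with [x] and [y], each of
    which is [\bot] or [a], and they cannot both be [\bot]. *)
Lemma atom_leU a x y : atom a -> (a <= x `|` y) = (a <= x) || (a <= y).
Proof.
move=> /atomP[a0 Ha]; apply/idP/orP => [|[]]; last 2 first.
- exact: lexUl.
- exact: lexUr.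
move=> axy; case: (Ha (a `&` x)) => [|ax0|/meet_idPl]; [exact: leIl| |by left].
case: (Ha (a `&` y)) => [|ay0|/meet_idPl]; [exact: leIl| |by right].
by case/eqP: a0; move/meet_idPl: axy; rewrite meetUr ax0 ay0 joinxx => <-.
Qed.

Lemma atom_le a b : atom a -> atom b -> (a <= b) = (a == b).
Proof.
move=> /atomP[/eqP a0 _] /atomP[_ Hb]; apply/idP/eqP => [/Hb[]|->] //.
Qed.

Lemma atom_le_joins (I : finType) (P : pred I) (F : I -> B) a : atom a ->
  (a <= \join_(i | P i) F i) = [exists i, P i && (a <= F i)].
Proof.
move=> aa; apply/idP/existsP => [a_le|[i /andP[Pi ai]]]; last first.
  by apply: (le_trans ai); apply: joins_sup.
apply/existsP; apply: contraLR a_le => /existsPn noi.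
apply: (big_ind (fun x => ~~ (a <= x))).
- by rewrite lex0; case/atomP: aa.
- by move=> x y ax ay; rewrite atom_leU // negb_or ax.
- by move=> i Pi; have := noi i; rewrite Pi.
Qed.

(** If [u] were not below [v], an atom under the nonzero difference of [u] and [v] would lie below
    [u] but be disjoint from [v]. *)
Lemma eq_atoms x y : (forall a, atom a -> (a <= x) = (a <= y)) -> x = y.
Proof.
have le_atoms u v : (forall a, atom a -> (a <= u) = (a <= v)) -> u <= v.
  move=> uv; rewrite -diff_eq0; apply/negPn/negP => /atom_exists[a aa].
  rewrite leBRL uv // => /andP[/meet_idPl-> /eqP a0].
  by case/atomP: aa => /eqP.
by move=> xy; apply/le_anti; rewrite !le_atoms // => a /xy.
Qed.

Notation A := {a : B | atom a}.

Lemma atom_le_join_atoms (P : pred A) (a : A) :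
  (val a <= \join_(b : A | P b) val b) = P a.
Proof.
rewrite atom_le_joins ?(valP a) //; apply/existsP/idP => [[b]|Pa].
  rewrite atom_le ?(valP a) ?(valP b) // => /andP[Pb /eqP ab].
  by rewrite (val_inj ab).
by exists a; rewrite Pa lexx.
Qed.

(** Sending [x] to the set of atoms below it is a bijection onto the sets of atoms; the join of a
    set of atoms gives the inverse. *)
Lemma card_atoms : #|B| = (2 ^ #|{: A}|)%N.
Proof.
pose f (x : B) : {set A} := [set a | val a <= x].
have fI : injective f.
  move=> x y /setP fxy; apply: eq_atoms => a aa.
  by have := fxy (exist _ a aa); rewrite !inE.
rewrite -[#|{: A}|]cardsT -card_powerset powersetT.
rewrite -[LHS]cardsT -(card_imset _ fI).
apply: eq_card => S; rewrite [RHS]inE; apply/imsetP.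
exists (\join_(b : A | b \in S) val b) => //.
by apply/setP=> a; rewrite inE atom_le_join_atoms.
Qed.

(** In this form, a condition on the join of a meet with [y] splits into one lower bound for each
    factor of the meet. *)
Lemma joinx_eq1 x y : (x `|` y == \top) = (~` y <= x).
Proof.
by rewrite -(inj_eq compl_inj) complU compl1 meetC disj_leC complK.
Qed.

Variable n : nat.
Implicit Types z : n.+1.-tuple B.

Lemma coordS z (i : 'I_n.+1) : coord z i.+1 = tnth z i.
Proof. by rewrite /coord /= inord_val. Qed.

Lemma BsetP z :
  reflect (forall i j : 'I_n.+1, (i < j)%N -> tnth z i `|` tnth z j = \top)
          (z \in Bset B n).
Proof.
rewrite inE; apply: (iffP forallP) => [Hz i j ij | Hz k].
  (* Coordinates count from 1 and ordinals from 0: condition [j] concerns the entry at ordinal [j]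
     and the meet of the entries at all smaller ordinals. *)
  have /implyP/(_ (leq_ltn_trans (leq0n i) ij)) := Hz j.
  rewrite joinx_eq1 coordS => /meetsP_seq/(_ i.+1).
  rewrite mem_index_iota coordS => /(_ ij isT) le_ji.
  by apply/eqP; rewrite joinx_eq1.
apply/implyP=> k_gt0; rewrite joinx_eq1 coordS; apply/meetsP_seq => i.
rewrite mem_index_iota => /andP[i_gt0 ik] _.
case: i i_gt0 ik => // i _; rewrite ltnS => ik.
pose j := Ordinal (ltn_trans ik (ltn_ord k)).
by rewrite -[i]/(val j) coordS -joinx_eq1 Hz.
Qed.

Lemma card_Dset : #|Dset B n| = (n.+1 ^ #|{: A}|)%N.
Proof.
(* [h a] is the coordinate missing the atom [a], with [ord0] meaning none. *)
pose Z (h : {ffun A -> 'I_n.+1}) : n.+1.-tuple B :=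
  [tuple \join_(b : A | (i == ord0) || (h b != i)) val b | i < n.+1].
have ZE h (a : A) i : (val a <= tnth (Z h) i) = (i == ord0) || (h a != i).
  by rewrite tnth_mktuple atom_le_join_atoms.
have ZI : injective Z.
  move=> h1 h2 eqZ; apply/ffunP=> a.
  have E i : (i == ord0) || (h1 a != i) = (i == ord0) || (h2 a != i).
    by rewrite -!ZE eqZ.
  (* Testing at [h2 a] forces equality unless [h2 a] is [ord0]; in that case, testing at [h1 a]
     forces [h1 a] to be [ord0] too. *)
  have := E (h1 a); have := E (h2 a); rewrite !eqxx !orbF.
  case: eqP => [-> _|_ /= /negPn/eqP //].
  by case: eqP => [->|_ /= /esym/negPn/eqP].
rewrite -[n.+1 in RHS]card_ord -card_ffun -cardsT -(card_imset _ ZI).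
apply: eq_card => z; rewrite inE -[1%N]/((ord0 : 'I_n.+1).+1) coordS.
apply/andP/imsetP => [[/BsetP Hz /eqP z0] | [h _ ->]]; last first.
  split.
    apply/BsetP=> i j ij; apply: eq_atoms => a aa; rewrite lex1 atom_leU //.
    rewrite -[a]/(val (exist _ a aa : A)) !ZE.
    case: (eqVneq (h _) i) => [->|_]; last by rewrite orbT.
    by rewrite -(inj_eq val_inj i j) neq_ltn ij !orbT.
  apply/eqP; apply: eq_atoms => a aa.
  by rewrite lex1 -[a]/(val (exist _ a aa : A)) ZE eqxx.
(* The default [ord0] cannot be confused with a missed coordinate, since the entry at [ord0] is
   [\top]. *)
exists [ffun a : A => odflt ord0 [pick i | ~~ (val a <= tnth z i)]] => //.
apply: eq_from_tnth => i; apply: eq_atoms => a aa.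
rewrite -[a]/(val (exist _ a aa : A)) ZE ffunE.
case: pickP => [j /= Nj | /= all_le]; last first.
  by rewrite (negbFE (all_le i)) eq_sym; case: eqVneq.
have [->|ij] := eqVneq i j.
  rewrite /= orbF (negbTE Nj); apply/esym/negbTE.
  by apply: contra Nj => /eqP->; rewrite z0 lex1.
rewrite /= orbT.
(* As [a] is not below entry [j], join-primeness puts it below every other entry. *)
have zij : tnth z i `|` tnth z j = \top.
  move: ij; rewrite -(inj_eq val_inj) neq_ltn => /orP[] /Hz //.
  by rewrite joinC.
by have := lex1 a; rewrite -zij atom_leU // (negbTE Nj) orbF.
Qed.

Lemma card_Booset : (0 < n)%N -> #|Booset B n| = #|B|.
Proof.
move=> n_gt0; pose i1 : 'I_n.+1 := Ordinal (n_gt0 : (1 < n.+1)%N).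
pose Z x : n.+1.-tuple B :=
  [tuple if i == ord0 then x else if i == i1 then ~` x else \top | i < n.+1].
have Z0 x : tnth (Z x) ord0 = x by rewrite tnth_mktuple.
have Z1 x : tnth (Z x) i1 = ~` x by rewrite tnth_mktuple.
have ZI : injective Z by move=> x y /(congr1 (fun z => tnth z ord0)); rewrite !Z0.
rewrite -[RHS]cardsT -(card_imset _ ZI); apply: eq_card => z.
rewrite inE -[1%N]/((ord0 : 'I_n.+1).+1) -[2%N]/(i1.+1) !coordS.
apply/andP/imsetP => [[/BsetP Hz /eqP z01] | [x _ ->]]; last first.
  rewrite Z0 Z1 meetxC; split=> //; apply/BsetP=> i j ij.
  rewrite !tnth_mktuple -!(inj_eq val_inj) /=.
  case: (nat_of_ord j) ij => [|[|?]] //; last by rewrite joinx1.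
  by case: (nat_of_ord i) => // _; rewrite joinxC.
exists (tnth z ord0) => //.
have z1E : tnth z i1 = ~` tnth z ord0.
  apply/le_anti; rewrite -disj_leC meetC z01 eqxx /=.
  by rewrite -joinx_eq1 joinC Hz.
apply: eq_from_tnth => i; rewrite tnth_mktuple.
case: eqP => [-> //|/eqP i_neq0]; case: eqP => [-> //|/eqP i_neq1].
have i_gt1 : (1 < i)%N.
  by move: i_neq0 i_neq1; rewrite -!(inj_eq val_inj) /=; case: (val i) => [|[]].
(* Replace [\bot] by the meet of the first two entries and distribute: both resulting joins are
   [\top]. *)
by rewrite -[LHS]join0x -z01 joinIl !Hz ?meetxx // ltnW.
Qed.

End FiniteBooleanAlgebra.

Theorem theorem5p5 (d : Order.disp_t) (B : finCTBDistrLatticeType d)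
    (n m : nat) (hn : 1 <= n) (hm : 1 <= m) (hB : #|B| = 2 ^ m) :
  #|Dset B n| = n.+1 ^ m /\ #|Booset B n| = 2 ^ m.
Proof.
split; last by rewrite card_Booset.
rewrite card_Dset; congr (_ ^ _).
(* The number of atoms is [m], by injectivity of powers of 2. *)
by apply/eqP; rewrite -(@eqn_exp2l 2) // -card_atoms hB.
Qed.
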